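(* Let $(X,\delta)$ be a metric space and let $T\colon X\to X$ be a firm non-expansive mapping such that $\rho(T)=0$. Then there exists a metric functional $h$ on $X$ such that, for every $x\in X$, $$h(Tx)\leq h(x).$$
   Context: A mapping $T\colon X\to X$ is non-expansive if $\delta(Tx,Ty)\leq\delta(x,y)$ for every $x,y\in X$. A mapping $T\colon X\to X$ is firm if there exist mappings $q,r,s,t\colon X\times X\to[0,+\infty[$ such that (A) $\inf_{(x,y)\in X\times X}t(x,y)>0$; (B) $\sup_{(x,y)\in X\times X}\big(q(x,y)+r(x,y)+s(x,y)+2t(x,y)\big)\leq 1$; (C) for every $x,y\in X$, $$\delta(Tx,Ty)\leq q(x,y)\,\delta(x,y)+r(x,y)\,\delta(x,Tx)+s(x,y)\,\delta(y,Ty)+t(x,y)\big[\delta(x,Ty)+\delta(Tx,y)\big].$$ $T$ is firm non-expansive if it is both firm and non-expansive. For non-expansive $T$, the linear rate of escape is $\rho(T):=\lim_{n\to\infty}\delta(x,T^{n}x)/n$; this limit exists and does not depend on $x\in X$. Metric functionals: fix an arbitrary base-point $x_0\in X$. For $w\in X$ let $h_w\colon X\to\mathbb{R}$, $h_w(\cdot):=\delta(\cdot,w)-\delta(x_0,w)$, and let $\Phi\colon X\to\mathbb{R}^X$, $\Phi(w):=h_w$. Endow $\mathbb{R}^X$ with the topology of point-wise convergence. A metric functional on $X$ is an element of the closure $\overline{\Phi(X)}$ in $\mathbb{R}^X$. *)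

(* Defs.v *)
From mathcomp Require Import all_boot all_order all_algebra.
From mathcomp Require Import all_classical all_reals all_analysis.
From mathcomp Require Import lra.

Set Implicit Arguments.
Unset Strict Implicit.
Unset Printing Implicit Defensive.

Import Order.TTheory GRing.Theory Num.Theory.
Import numFieldNormedType.Exports.

Local Open Scope classical_set_scope.
Local Open Scope ring_scope.

Definition nonexpansive (R : realType) (X : metricType R) (T : X -> X) : Prop :=
  forall x y, mdist (T x) (T y) <= mdist x y.

(* Extrema are taken in the extended reals because the real-valued [sup]
   of an unbounded set is 0. *)
Definition firm (R : realType) (X : metricType R) (T : X -> X) : Prop :=
  exists q r s t : X * X -> R,
    [/\ forall p, [/\ 0 <= q p, 0 <= r p, 0 <= s p & 0 <= t p],
        (0 < ereal_inf (range (fun p => (t p)%:E)))%E,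
        (ereal_sup (range (fun p => (q p + r p + s p + 2 * t p)%:E)) <= 1)%E &
        forall x y, mdist (T x) (T y) <=
          q (x, y) * mdist x y + r (x, y) * mdist x (T x)
          + s (x, y) * mdist y (T y)
          + t (x, y) * (mdist x (T y) + mdist (T x) y)].

Definition escape_rate (R : realType) (X : metricType R) (T : X -> X) (x : X)
    : R :=
  lim ((mdist x (iter n T x) / n%:R) @[n --> \oo]).

Definition internal_functional (R : realType) (X : metricType R) (x0 w : X)
    : {ptws X -> R} :=
  fun x => mdist x w - mdist x0 w.

Definition metric_functional (R : realType) (X : metricType R) (x0 : X)
    : set {ptws X -> R} :=
  closure (range (internal_functional x0)).

(* For a nonexpansive map the limit defining [escape_rate] exists (so that [lim]
   does not return its default value) and does not depend on the point. *)
Section EscapeRate.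
Context (R : realType) (X : metricType R) (T : X -> X).
Hypothesis Tne : nonexpansive T.

Let nonexpansive_iter n x y : mdist (iter n T x) (iter n T y) <= mdist x y.
Proof. by elim: n => //= n; apply: le_trans; exact: Tne. Qed.

Let a x n : R := mdist x (iter n T x).

Let a_ge0 x n : 0 <= a x n. Proof. exact: mdist_ge0. Qed.

Let aD x m n : a x (m + n) <= a x m + a x n.
Proof.
apply: le_trans (metric_triangle x (iter m T x) _) _.
by rewrite iterD lerD2l nonexpansive_iter.
Qed.

Let aM x m n : a x (n * m) <= n%:R * a x m.
Proof.
elim: n => [|n IH]; first by rewrite mul0n mul0r /a /= mdistxx.
rewrite mulSn -nat1r mulrDl mul1r.
by apply: le_trans (aD _ _ _) _; rewrite lerD2l.
Qed.

Lemma escape_rate_cvg x :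
  (mdist x (iter n T x) / n%:R) @[n --> \oo] --> escape_rate T x.
Proof.
pose S := [set a x n.+1 / n.+1%:R | n in [set: nat]].
have S0 : S !=set0 by exists (a x 1 / 1%:R), 0%N.
have hS : has_inf S.
  by split=> //; exists 0 => _ [n _ <-]; rewrite divr_ge0 ?a_ge0 ?ler0n.
suff cv : (mdist x (iter n T x) / n%:R) @[n --> \oo] --> inf S.
  rewrite /escape_rate; have -> := cvg_lim _ cv; first exact: cv.
  exact: norm_hausdorff.
apply/cvgrPdist_le => /= e e0.
have e20 : 0 < e / 2 by rewrite divr_gt0.
have [_ [k _ <-] kS] := inf_adherent e20 hS.
pose m := k.+1.
have [C CP] : exists C : R, 0 <= C /\ forall r, (r < m)%N -> a x r <= C.
  exists (\sum_(r < m) a x r); split; first by apply: sumr_ge0 => *; exact: a_ge0.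
  move=> r rm; rewrite (bigD1 (Ordinal rm)) //= lerDl.
  by apply: sumr_ge0 => *; exact: a_ge0.
case: CP => C0 CP.
near=> n.
have n0 : (0 < n)%N by near: n; exists 1%N.
have nR0 : 0 < n%:R :> R by rewrite ltr0n.
have mR0 : 0 < m%:R :> R by rewrite ltr0n.
have lo : inf S <= a x n / n%:R.
  apply: ge_inf; first by case: hS.
  by exists n.-1 => //; rewrite prednK.
have hi : a x n / n%:R <= a x m / m%:R + C / n%:R.
  rewrite [X in a x X / _](divn_eq n m) ler_pdivrMr// mulrDl divfK ?gt_eqF//.
  apply: le_trans (aD _ _ _) _.
  apply: lerD; last by apply: CP; rewrite ltn_pmod.
  apply: le_trans (aM _ _ _) _.
  rewrite mulrC -mulrA ler_wpM2l ?a_ge0// mulrC ler_pdivlMr//.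
  by rewrite -natrM ler_nat leq_divM.
have Cn : C / n%:R <= e / 2.
  rewrite ler_pdivrMr// mulrC -ler_pdivrMr//.
  near: n; exact: nbhs_infty_ger.
rewrite -/(a x n) distrC ger0_norm ?subr_ge0//.
rewrite -/m in kS; move: lo hi Cn kS; lra.
Unshelve. all: by end_near. Qed.

Lemma escape_rate_indep x y : escape_rate T x = escape_rate T y.
Proof.
have axy u v n : a u n <= a v n + 2 * mdist u v.
  have h1 := metric_triangle u v (iter n T u).
  have h2 := metric_triangle v (iter n T v) (iter n T u).
  have h3 := nonexpansive_iter n v u.
  by move: h1 h2 h3; rewrite /a (metric_sym v u); lra.
have le u v : escape_rate T u <= escape_rate T v.
  have cC : (a v n / n%:R + 2 * mdist u v / n%:R) @[n --> \oo]
      --> escape_rate T v + 0.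
    apply: cvgD; first exact: escape_rate_cvg.
    have -> : 0 = 2 * mdist u v * 0 :> R by rewrite mulr0.
    apply: cvgM; first exact: cvg_cst.
    apply/gtr0_cvgV0; last exact: cvgr_idn.
    by near=> n; rewrite ltr0n; near: n; exists 1%N.
  rewrite -[leRHS]addr0.
  apply: (ler_cvg_to (@escape_rate_cvg u) cC).
  by near=> n; rewrite -mulrDl ler_wpM2r ?invr_ge0 ?ler0n//; exact: axy.
by apply/eqP; rewrite eq_le !le.
Unshelve. all: by end_near. Qed.

End EscapeRate.

(* Main.v *)
Require Import Defs.
From mathcomp Require Import all_boot all_order all_algebra.
From mathcomp Require Import all_classical all_reals all_analysis.
From mathcomp Require Import lra.
Import Order.TTheory GRing.Theory Num.Theory.
Import numFieldNormedType.Exports.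
Local Open Scope classical_set_scope.
Local Open Scope ring_scope.

(** Two independent facts give the theorem.

    Firmness makes orbits asymptotically straight
    ([firm_orbit_straight]): if [d] is the infimum of the displacements
    [mdist (T^n x) (T^(n+1) x)], then [k * d] bounds from below the distance
    between any two points of the orbit that are [k] steps apart. Hence
    [mdist x (T^k x) / k >= d] for every [k > 0], so [d] is at most the rate of
    escape ([displacement_inf_le_escape_rate]). When the rate is zero, so is
    [d], and the orbit contains points that [T] moves arbitrarily little.

    Nonexpansiveness turns such points [w] into a functional
    ([approximate_fixed_points_functional]): since
    [mdist (T x) w <= mdist (T x) (T w) + mdist (T w) w
                   <= mdist x w + mdist w (T w)],
    the internal functional of [w] increases along [T] by at most
    [mdist w (T w)]. By Tychonoff's theorem internal functionals lie in a
    compact set, and a cluster point of them along [mdist w (T w) -> 0] does not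
    increase along [T]. *)

Lemma displacement_nonincreasing {R : realType} {X : metricType R} {T : X -> X}
    (Tne : nonexpansive T) (x : X) {m n : nat} (k : nat) : (m <= n)%N ->
  mdist (iter n T x) (iter (n + k) T x) <= mdist (iter m T x) (iter (m + k) T x).
Proof.
move=> /subnK <-; elim: (n - m)%N => // j; apply: le_trans.
by rewrite !addSn; exact: Tne.
Qed.

Lemma mdist_orbit_le {R : realType} {X : metricType R} {T : X -> X}
    (Tne : nonexpansive T) (x : X) (n k : nat) :
  mdist (iter n T x) (iter (n + k) T x) <=
    k%:R * mdist (iter n T x) (iter n.+1 T x).
Proof.
elim: k => [|k IH]; first by rewrite addn0 mdistxx mul0r.
have := displacement_nonincreasing Tne x 1 (leq_addr k n).
have := metric_triangle (iter n T x) (iter (n + k) T x) (iter (n + k.+1) T x).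
rewrite !addn1 addnS -nat1r mulrDl; move: IH; lra.
Qed.

(** The extended-real extrema in [firm], in pointwise form: the weights vary
    with the pair of points, but [c] bounds the last one below uniformly. *)
Lemma firm_real_bounds {R : realType} {X : metricType R} {T : X -> X} :
    firm T ->
  exists2 c : R, 0 < c & forall x y, exists q r s t : R,
    [/\ [/\ 0 <= q, 0 <= r, 0 <= s & c <= t], q + r + s + 2 * t <= 1 &
        mdist (T x) (T y) <=
          q * mdist x y + r * mdist x (T x) + s * mdist y (T y)
          + t * (mdist x (T y) + mdist (T x) y)].
Proof.
move=> [q [r [s [t [ge0 inft supqrst Tle]]]]].
have [c c0 ct] : exists2 c : R, 0 < c & forall p, c <= t p.
  have inf_le p : (ereal_inf (range (fun p => (t p)%:E)) <= (t p)%:E)%E.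
    by apply: ereal_inf_lbound; exists p.
  case: (ereal_inf _) inft inf_le => [c||] //= c0 ct.
  - by exists c => [|p]; rewrite -?lte_fin// -lee_fin.
  - by exists 1 => // p; have := ct p.
exists c => // x y; exists (q (x, y)), (r (x, y)), (s (x, y)), (t (x, y)).
have [? ? ? ?] := ge0 (x, y); split => //.
rewrite -lee_fin; apply: le_trans supqrst.
by apply: ereal_sup_ubound; exists (x, y).
Qed.

(** One step of the lower bound, with the distances abstracted to reals: [a]
    and [a'] stand for points [k] steps apart, [u] and [v] for consecutive
    points, [b] and [b'] for points [k + 1] and [k - 1] steps apart. All the
    distances other than [a'] and [b] being at most the number of steps times
    [d + e], spending the budget [q + r + s + 2 t <= 1] forces [b] to be at
    least [(k + 1) d - k e / t]; the lower bound on [t] keeps this error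
    small. *)
Lemma firm_spread_step {R : realType} (k d e q r s t a a' u v b b' : R) :
  1 <= k -> 0 <= d -> 0 <= e ->
  0 <= q -> 0 <= r -> 0 <= s -> 0 <= t -> q + r + s + 2 * t <= 1 ->
  k * d <= a' -> a' <= q * a + r * u + s * v + t * (b + b') ->
  a <= k * (d + e) -> u <= d + e -> v <= d + e -> b' <= (k - 1) * (d + e) ->
  t * ((k + 1) * d) - k * e <= t * b.
Proof.
move=> k1 d0 e0 q0 r0 s0 t0 qrst lo hi ha hu hv hb'.
have k0 : 0 <= k by lra.
have D0 : 0 <= d + e by lra.
have kD0 : 0 <= k * (d + e) by rewrite mulr_ge0.
have uk : d + e <= k * (d + e) by rewrite ler_peMl.
have A := ler_wpM2l q0 ha.
have U := ler_wpM2l r0 (le_trans hu uk).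
have V := ler_wpM2l s0 (le_trans hv uk).
have B := ler_wpM2l t0 hb'.
have S := ler_wpM2r kD0 qrst.
have E : 0 <= t * ((k + 1) * e) by rewrite !mulr_ge0//; lra.
move: lo hi A U V B S E; lra.
Qed.

(** By induction on [k]. Far enough along the orbit the displacements are at
    most [d + e], so the triangle inequality bounds every distance there from
    above, and [firm_spread_step] turns the exact lower bounds for [k] into one
    for [k + 1] up to an error proportional to [e]. Distances between points a
    fixed number of steps apart do not increase along the orbit, so this bound
    also holds at the given [n]; then [e] tends to 0. *)
Lemma firm_orbit_straight {R : realType} {X : metricType R} {T : X -> X}
    (Tfirm : firm T) (Tne : nonexpansive T) (x : X) (n k : nat) :
  k%:R * inf (range (fun j => mdist (iter j T x) (iter j.+1 T x))) <=
    mdist (iter n T x) (iter (n + k) T x).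
Proof.
set S := range _; set d := inf S.
have Slb : lbound S 0 by move=> _ [j _ <-]; exact: mdist_ge0.
have Sinf : has_inf S.
  by split; [exists (mdist x (T x)), 0%N | exists 0].
have d0 : 0 <= d by apply: lb_le_inf => //; case: Sinf.
have dle j : d <= mdist (iter j T x) (iter j.+1 T x).
  by apply: ge_inf; [exists 0 | exists j].
have [c c0 firmc] := firm_real_bounds Tfirm.
elim: k n => [|[|k] IH] n; first by rewrite mul0r mdist_ge0.
  by rewrite mul1r addn1.
apply/ler_addgt0Pr => /= e' e'0.
(* The error [k.+1 * e] of one step, divided by [t >= c], must be at most
   [e']. *)
pose e : R := e' * c / k.+1%:R.
have e0 : 0 < e by rewrite divr_gt0 ?mulr_gt0.
have [_ [N _ <-] dN] := inf_adherent e0 Sinf.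
pose m := maxn n N.
have nm : (n <= m)%N by exact: leq_maxl.
have small j : (m <= j)%N -> mdist (iter j T x) (iter j.+1 T x) <= d + e.
  move=> mj; apply: le_trans (ltW dN).
  rewrite -[j.+1]addn1 -[N.+1]addn1; apply: displacement_nonincreasing => //.
  exact: leq_trans (leq_maxr _ _) mj.
have far j i : (m <= j)%N ->
    mdist (iter j T x) (iter (j + i) T x) <= i%:R * (d + e).
  move=> mj; apply: le_trans (mdist_orbit_le Tne x j i) _.
  by rewrite ler_wpM2l// small.
apply: le_trans (lerD (displacement_nonincreasing Tne x k.+2 nm) (lexx e')).
have [q [r [s [t [[q0 r0 s0 ct] qrst Tle]]]]] :=
  firmc (iter m T x) (iter (m + k.+1) T x).
have t0 : 0 < t by exact: lt_le_trans ct.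
have := @firm_spread_step R k.+1%:R d e q r s t
  (mdist (iter m T x) (iter (m + k.+1) T x))
  (mdist (iter m.+1 T x) (iter (m.+1 + k.+1) T x))
  (mdist (iter m T x) (iter m.+1 T x))
  (mdist (iter (m + k.+1) T x) (iter (m + k.+1).+1 T x))
  (mdist (iter m T x) (iter (m + k.+2) T x))
  (mdist (iter m.+1 T x) (iter (m.+1 + k) T x)).
move=> /(_ _ d0 (ltW e0) q0 r0 s0 (ltW t0) qrst (IH _) _ (far _ _ _) (small _ _)
  (small _ _)) H.
have {H} : t * ((k.+1%:R + 1) * d) - k.+1%:R * e <=
    t * mdist (iter m T x) (iter (m + k.+2) T x).
  apply: H => //; first by rewrite ler1n.
  - by move: Tle; rewrite -!iterS !addnS !addSn.
  - exact: leq_addr.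
  - by rewrite -natr1 addrK far.
have -> : k.+1%:R * e = c * e' by rewrite /e mulrC divfK// mulrC.
have cte := ler_wpM2r (ltW e'0) ct.
rewrite natr1 => step; rewrite -lerBlDr -(ler_pM2l t0); move: cte step; lra.
Qed.

Lemma displacement_inf_le_escape_rate {R : realType} {X : metricType R}
    {T : X -> X} (Tfirm : firm T) (Tne : nonexpansive T) (x : X) :
  inf (range (fun n => mdist (iter n T x) (iter n.+1 T x))) <= escape_rate T x.
Proof.
apply: (cvgr_to_ge (@escape_rate_cvg _ _ _ Tne x)); near=> n.
have n0 : 0 < n%:R :> R by rewrite ltr0n; near: n; exists 1%N.
rewrite ler_pdivlMr// mulrC.
exact: (firm_orbit_straight Tfirm Tne x 0 n).
Unshelve. all: by end_near. Qed.

Lemma internal_functional_step {R : realType} {X : metricType R} {T : X -> X}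
    (Tne : nonexpansive T) (x0 w x : X) :
  internal_functional x0 w (T x) - internal_functional x0 w x <= mdist w (T w).
Proof.
rewrite /internal_functional.
have := metric_triangle (T x) (T w) w; have := Tne x w.
rewrite (metric_sym (T w) w); lra.
Qed.

(** Each value of an internal functional at [x] lies between
    [- mdist x x0] and [mdist x x0], independently of its centre. *)
Lemma internal_functionals_compact {R : realType} {X : metricType R} (x0 : X) :
  exists2 K : set {ptws X -> R},
    compact K & forall w, K (internal_functional x0 w).
Proof.
exists [set f | forall x, `[- mdist x x0, mdist x x0]%classic (f x)].
  exact: (@tychonoff X (fun=> R) _ (fun x => @segment_compact R _ _)).
move=> w x; rewrite /= in_itv /= /internal_functional.
have := metric_triangle x x0 w; have := metric_triangle x0 x w.
rewrite (metric_sym x0 x) => h1 h2; apply/andP; split; move: h1 h2; lra.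
Qed.

Lemma closed_step_le {R : realType} {X : metricType R} (T : X -> X) (x : X)
    (e : R) : closed [set f : {ptws X -> R} | f (T x) - f x <= e].
Proof.
apply: (@preimage_closed {ptws X -> R} R (fun f => f (T x) - f x)
  [set y | y <= e] _ (@closed_le R e)) => f _.
by apply: (@continuousB R R {ptws X -> R} (fun f => f (T x)) (fun f => f x));
  exact: (@proj_continuous X (fun=> R)).
Qed.

Lemma approximate_fixed_points_functional {R : realType} {X : metricType R}
    (x0 : X) {T : X -> X} (Tne : nonexpansive T)
    (almost_fixed : forall e : R, 0 < e -> exists w, mdist w (T w) <= e) :
  exists2 h : {ptws X -> R},
    metric_functional x0 h & forall x : X, h (T x) <= h x.
Proof.
pose B (e : R) : set {ptws X -> R} :=
  internal_functional x0 @` [set w | mdist w (T w) <= e].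
pose F := filter_from [set e : R | 0 < e] B.
have FF : ProperFilter F.
  apply: filter_from_proper => [|e /almost_fixed[w we]]; last first.
    by exists (internal_functional x0 w), w.
  apply: filter_from_filter => [|e1 e2 /= e10 e20]; first by exists 1 => /=.
  exists (Num.min e1 e2); first by rewrite /= lt_min e10.
  by move=> _ [w + <-]; rewrite /= le_min => /andP[w1 w2]; split; exists w.
have [K Kcompact Kint] := internal_functionals_compact x0.
have [h [_]] : K `&` cluster F !=set0.
  apply: Kcompact; exists 1 => //= _ [w _ <-]; exact: Kint.
(* A cluster point of [F] lies in the closure of every [B e], and the
   inequality up to [e] is a closed condition satisfied on [B e]. *)
rewrite clusterE => hF; exists h => [|x].
  by apply: hF; exists 1 => //= _ [w _ <-]; exists w.
apply/ler_addgt0Pr => e e0; rewrite addrC -lerBlDr.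
have := hF [set f | f (T x) - f x <= e].
rewrite -(closure_id _).1; last exact: closed_step_le.
apply; exists e => // _ [w we <-] /=.
exact: le_trans (internal_functional_step Tne x0 w x) we.
Qed.

Theorem corollary1p2 (R : realType) (X : metricType R) (x0 : X) (T : X -> X)
    (Tfirm : firm T) (Tne : nonexpansive T) (T0 : escape_rate T x0 = 0) :
  exists2 h : {ptws X -> R},
    metric_functional x0 h & forall x : X, h (T x) <= h x.
Proof.
apply: approximate_fixed_points_functional => // e e0.
have Sinf : has_inf (range (fun n => mdist (iter n T x0) (iter n.+1 T x0))).
  split; first by exists (mdist x0 (T x0)), 0%N.
  by exists 0 => _ [j _ <-]; exact: mdist_ge0.
have [_ [n _ <-] le_e] := inf_adherent e0 Sinf.
exists (iter n T x0); apply: (le_trans (ltW le_e)).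
by rewrite gerDr -T0 displacement_inf_le_escape_rate.
Qed.
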